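(* Let $s>0$ be real and let $x\in[-1,1]$. Then $$Li_{s+1}(x)=\sum_{n=1}^{\infty}\frac{1}{n2^n}\sum_{k=1}^{n}\binom{n}{k}\frac{x^k}{k^s}.$$ In particular, taking $x=1$ and $x=-1$ respectively, $$\varsigma(s+1)=\sum_{n=1}^{\infty}\frac{1}{n2^n}\sum_{k=1}^{n}\binom{n}{k}\frac{1}{k^s},\qquad \varsigma_a(s+1)=\sum_{n=1}^{\infty}\frac{1}{n2^n}\sum_{k=1}^{n}\binom{n}{k}\frac{(-1)^{k+1}}{k^s}.$$
   Context: $Li_s(x)=\sum_{n=1}^{\infty}\frac{x^n}{n^s}$ is the polylogarithm; $\varsigma(s)=\sum_{n=1}^\infty \frac1{n^s}$ is the Riemann zeta function and $\varsigma_a(s)=\sum_{n=1}^{\infty}\frac{(-1)^{n+1}}{n^s}$ is the alternating zeta function. *)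

(* Defs.v *)
(* Stdlib reals with Coquelicot. *)
From Stdlib Require Import Reals.
From Coquelicot Require Import Coquelicot.
Open Scope R_scope.

(* Coquelicot's series are indexed from 0, whereas all series here start at
   n = 1: [from1 a] is the sequence a 1, a 2, a 3, ... *)
Definition from1 (a : nat -> R) : nat -> R := fun n => a (S n).

(* [Rpower (INR n) s] is n^s only for n >= 1; the terms at n = 0 are never used. *)
Definition polylog_term (s x : R) (n : nat) : R := x ^ n / Rpower (INR n) s.
Definition zeta_term (s : R) (n : nat) : R := 1 / Rpower (INR n) s.
Definition alt_zeta_term (s : R) (n : nat) : R :=
  (-1) ^ (n + 1) / Rpower (INR n) s.

(* [Series] is a total operator, so these are meaningful only where the series
   converges; convergence has to be stated separately with [ex_series]. *)
Definition polylog (s x : R) : R := Series (from1 (polylog_term s x)).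
Definition zeta (s : R) : R := Series (from1 (zeta_term s)).
Definition alt_zeta (s : R) : R := Series (from1 (alt_zeta_term s)).

(* Main.v *)
Require Import Defs.
From Stdlib Require Import Reals Lra Lia.
From Coquelicot Require Import Coquelicot.
Open Scope R_scope.

(** The identity is an interchange of two summations. Since
    [C n k / n = C (n - 1) (k - 1) / k], the series on the right is
    [sum_n sum_(k <= n) p n k * x^k / k^(s+1)] with the weights
    [p n k = C (n - 1) (k - 1) / 2^n]: the probability that, in fair coin
    tossing, the [k]-th head comes up at toss [n]. The [k]-th head comes up
    eventually, so [sum_n p n k = 1] for every [k] ([is_series_kth_head]), and
    summing over [n] first leaves the polylogarithm series.

    To justify the interchange, the partial sum up to [N] of the right-hand side
    is written as [sum_(k <= N) P N k * x^k / k^(s+1)], where [P N k] lies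
    between 0 and 1 and tends to [1] as [N] grows ([sum_n_triangular]). As
    [sum_k 1 / k^(s+1)] converges ([ex_series_inv_Rpower]), dominated
    convergence for series ([is_lim_seq_tannery]) gives the limit.
    The powers [x^k] enter only through the bound [|x^k| <= 1], so the
    argument is carried out for a bounded numerator
    ([dirichlet_acceleration]); the numerators [1] and [(-1)^(k+1)] give the
    two zeta formulas. *)

(** Sums and equalities in the algebraic structures of the real line, restated
    in [R] itself so that [ring] recognizes them. *)
Ltac ring_R :=
  change plus with Rplus;
  match goal with |- @eq _ ?x ?y => change (@eq R x y) end; simpl; ring.

(** * Series with nonnegative terms, and dominated convergence *)

Lemma ex_series_nonneg_bounded (a : nat -> R) (M : R) :
  (forall n, 0 <= a n) -> (forall n, sum_n a n <= M) -> ex_series a.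
Proof.
  intros Ha HM.
  destruct (ex_finite_lim_seq_incr (sum_n a) M) as [l Hl].
  - intros n. rewrite sum_Sn. change plus with Rplus. specialize (Ha (S n)). lra.
  - exact HM.
  - now exists l.
Qed.

Lemma is_lim_seq_sum_n_0 (u : nat -> nat -> R) (K : nat) :
  (forall k, is_lim_seq (fun N => u N k) 0) ->
  is_lim_seq (fun N => sum_n (u N) K) 0.
Proof.
  intros Hu. induction K as [|K IH].
  - apply is_lim_seq_ext with (fun N => u N 0%nat); [|apply Hu].
    intros N. now rewrite sum_O.
  - apply is_lim_seq_ext with (fun N => sum_n (u N) K + u N (S K)).
    + intros N. now rewrite sum_Sn.
    + replace (Finite 0) with (Rbar_plus 0 0) by (simpl; f_equal; ring).
      apply is_lim_seq_plus'; auto.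
Qed.

(** The terms beyond a fixed [K] contribute at most a tail of the convergent
    series of [Rabs (b k)], uniformly in [N]; the finitely many others tend
    to 0. *)
Lemma is_lim_seq_tannery (c : nat -> nat -> R) (b : nat -> R) :
  (forall N k, Rabs (c N k) <= 1) ->
  (forall k, is_lim_seq (fun N => c N k) 0) ->
  ex_series (fun k => Rabs (b k)) ->
  is_lim_seq (fun N => sum_n (fun k => c N k * b k) N) 0.
Proof.
  intros Hc1 Hc0 Hb. apply is_lim_seq_spec. intros eps.
  assert (He : 0 < eps / 2) by (generalize (cond_pos eps); lra).
  destruct (Cauchy_ex_series _ Hb (mkposreal _ He)) as [K HK]. simpl in HK.
  assert (Hhead : is_lim_seq (fun N => sum_n (fun k => c N k * b k) K) 0).
  { apply is_lim_seq_sum_n_0. intros k.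
    replace (Finite 0) with (Rbar_mult 0 (b k)) by (simpl; f_equal; ring).
    apply is_lim_seq_mult'; [apply Hc0 | apply is_lim_seq_const]. }
  apply is_lim_seq_spec in Hhead.
  destruct (Hhead (mkposreal _ He)) as [N0 HN0]. simpl in HN0.
  exists (S (max K N0)). intros N HN.
  specialize (HN0 N ltac:(lia)).
  unfold sum_n at 1. rewrite sum_n_m_Chasles with (m := K) by lia.
  change (sum_n_m (fun k => c N k * b k) 0 K)
    with (sum_n (fun k => c N k * b k) K).
  change plus with Rplus.
  assert (Htail : Rabs (sum_n_m (fun k => c N k * b k) (S K) N) < eps / 2).
  { eapply Rle_lt_trans; [apply (norm_sum_n_m (V := R_NormedModule))|].
    eapply Rle_lt_trans; [|apply (HK (S K) N); lia].
    eapply Rle_trans; [|apply Rle_abs].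
    apply sum_n_m_le. intros k. change norm with Rabs.
    rewrite Rabs_mult. generalize (Rabs_pos (b k)) (Hc1 N k). nra. }
  rewrite Rminus_0_r in *.
  eapply Rle_lt_trans; [apply Rabs_triang|]. lra.
Qed.

(** * Interchange of summation for triangular weights *)

Lemma sum_n_triangular (p : nat -> nat -> R) (b : nat -> R) (N : nat) :
  (forall n k, (n < k)%nat -> p n k = 0) ->
  sum_n (fun n => sum_n (fun k => p n k * b k) n) N =
  sum_n (fun k => sum_n (fun n => p n k) N * b k) N.
Proof.
  intros Hp. induction N as [|N IH].
  - now rewrite !sum_O.
  - rewrite sum_Sn, IH.
    rewrite (sum_n_ext (fun k => sum_n (fun n => p n k) (S N) * b k)
      (fun k => plus (sum_n (fun n => p n k) N * b k) (p (S N) k * b k))).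
    2:{ intros k. rewrite sum_Sn. ring_R. }
    rewrite sum_n_plus. f_equal. rewrite sum_Sn.
    (* no earlier row reaches the new column *)
    rewrite (sum_n_ext_loc (fun n => p n (S N)) (fun _ => 0) N)
      by (intros n Hn; apply Hp; lia).
    rewrite sum_n_const. rewrite Rmult_0_r, Rmult_0_l.
    symmetry. apply Rplus_0_r.
Qed.

Lemma is_series_triangular (p : nat -> nat -> R) (b : nat -> R) :
  (forall n k, 0 <= p n k) ->
  (forall n k, (n < k)%nat -> p n k = 0) ->
  (forall k, is_series (fun n => p n k) 1) ->
  ex_series (fun k => Rabs (b k)) ->
  is_series (fun n => sum_n (fun k => p n k * b k) n) (Series b).
Proof.
  intros Hpos Htri Hone Hb.
  assert (Hle1 : forall N k, sum_n (fun n => p n k) N <= 1).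
  { intros N k.
    apply (is_lim_seq_incr_compare (sum_n (fun n => p n k)) 1 (Hone k)).
    intros n. rewrite sum_Sn. change plus with Rplus.
    specialize (Hpos (S n) k). lra. }
  assert (Hge0 : forall N k, 0 <= sum_n (fun n => p n k) N).
  { intros N k. induction N as [|N IH].
    - rewrite sum_O. apply Hpos.
    - rewrite sum_Sn. change plus with Rplus. specialize (Hpos (S N) k). lra. }
  assert (Hsum : is_lim_seq (sum_n b) (Series b)).
  { apply Series_correct. now apply ex_series_Rabs. }
  assert (Hdef : is_lim_seq
    (fun N => sum_n (fun k => (sum_n (fun n => p n k) N - 1) * b k) N) 0).
  { apply is_lim_seq_tannery; auto.
    - intros N k. apply Rabs_le. specialize (Hle1 N k). specialize (Hge0 N k). lra.
    - intros k. replace (Finite 0) with (Finite (1 - 1)) by (f_equal; ring).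
      apply is_lim_seq_minus'; [apply (Hone k) | apply is_lim_seq_const]. }
  change (is_lim_seq (sum_n (fun n => sum_n (fun k => p n k * b k) n)) (Series b)).
  replace (Finite (Series b)) with (Finite (0 + Series b)) by (f_equal; ring).
  eapply is_lim_seq_ext; [|exact (is_lim_seq_plus' _ _ _ _ Hdef Hsum)].
  intros N. rewrite sum_n_triangular by assumption. cbv beta.
  change Rplus with (@plus R_AbelianMonoid). rewrite <- sum_n_plus.
  apply sum_n_ext. intros k. ring_R.
Qed.

(** * Waiting times in fair coin tossing *)

(** The probability that head number [k + 1] comes up at toss number [n + 1],
    by conditioning on the first toss. The closed form [C n k / 2 ^ (n + 1)] is
    wrong for [n < k], where the truncated difference [n - k] in the factorial
    formula makes [C n k] nonzero. *)
Fixpoint kth_head (n k : nat) : R :=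
  match n, k with
  | O, O => / 2
  | O, S _ => 0
  | S n, O => kth_head n 0 / 2
  | S n, S k => (kth_head n k + kth_head n (S k)) / 2
  end.

Lemma kth_head_nonneg (n k : nat) : 0 <= kth_head n k.
Proof.
  revert k. induction n as [|n IH]; intros [|k]; simpl; try lra.
  - generalize (IH 0%nat). lra.
  - generalize (IH k) (IH (S k)). lra.
Qed.

Lemma kth_head_early (n k : nat) : (n < k)%nat -> kth_head n k = 0.
Proof.
  revert k. induction n as [|n IH]; intros [|k] H; simpl; try lia; auto.
  rewrite !IH by lia. lra.
Qed.

Lemma C_0_r (n : nat) : Binomial.C n 0 = 1.
Proof.
  unfold Binomial.C. rewrite Nat.sub_0_r. simpl (Factorial.fact 0).
  rewrite INR_1. field. apply INR_fact_neq_0.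
Qed.

Lemma C_diag (n : nat) : Binomial.C n n = 1.
Proof. now rewrite (pascal_step1 n n), Nat.sub_diag, C_0_r by lia. Qed.

Lemma kth_head_binomial (n k : nat) :
  (k <= n)%nat -> kth_head n k = Binomial.C n k / 2 ^ S n.
Proof.
  revert k. induction n as [|n IH]; intros [|k] H; try lia.
  - rewrite C_0_r. simpl. field.
  - simpl kth_head. rewrite IH, !C_0_r by lia. simpl. field.
    apply pow_nonzero. lra.
  - simpl kth_head. rewrite IH by lia.
    destruct (Nat.eq_dec k n) as [->|Hk].
    + rewrite kth_head_early, !C_diag by lia. simpl. field.
      apply pow_nonzero. lra.
    + rewrite IH, <- pascal by lia. simpl. field. apply pow_nonzero. lra.
Qed.

Lemma sum_kth_head_0 (N : nat) :
  sum_n (fun n => kth_head n 0) N = 1 - kth_head N 0.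
Proof.
  induction N as [|N IH].
  - rewrite sum_O. simpl. lra.
  - rewrite sum_Sn, IH. change plus with Rplus. simpl. lra.
Qed.

Lemma sum_kth_head_S (k N : nat) :
  sum_n (fun n => kth_head n (S k)) (S N) =
  (sum_n (fun n => kth_head n k) N + sum_n (fun n => kth_head n (S k)) N) / 2.
Proof.
  induction N as [|N IH].
  - rewrite sum_Sn, !sum_O. change plus with Rplus. simpl. lra.
  - assert (HS := sum_Sn (fun n => kth_head n (S k)) N).
    rewrite (sum_Sn _ (S N)), (sum_Sn (fun n => kth_head n k) N).
    change plus with Rplus in *.
    change (kth_head (S (S N)) (S k))
      with ((kth_head (S N) k + kth_head (S N) (S k)) / 2). lra.
Qed.

Lemma sum_kth_head_le_1 (k N : nat) : sum_n (fun n => kth_head n k) N <= 1.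
Proof.
  revert k. induction N as [|N IH]; intros [|k].
  - rewrite sum_O. simpl. lra.
  - rewrite sum_O. simpl. lra.
  - rewrite sum_kth_head_0. generalize (kth_head_nonneg (S N) 0). lra.
  - rewrite sum_kth_head_S. generalize (IH k) (IH (S k)). lra.
Qed.

Lemma kth_head_0 (n : nat) : kth_head n 0 = / 2 * (/ 2) ^ n.
Proof. induction n as [|n IH]; simpl; [|rewrite IH]; lra. Qed.

(** Every head comes up almost surely. With [l k] the sum over [n], the
    recursion on the first toss passes to the limit as
    [l (k + 1) = (l k + l (k + 1)) / 2], so all [l k] equal [l 0 = 1]. *)
Lemma is_series_kth_head (k : nat) : is_series (fun n => kth_head n k) 1.
Proof.
  induction k as [|k IH].
  - change (is_lim_seq (sum_n (fun n => kth_head n 0)) 1).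
    replace (Finite 1) with (Finite (1 - / 2 * 0)) by (f_equal; ring).
    apply is_lim_seq_ext with (fun N => 1 - / 2 * (/ 2) ^ N).
    { intros N. now rewrite sum_kth_head_0, kth_head_0. }
    apply is_lim_seq_minus'; [apply is_lim_seq_const|].
    apply is_lim_seq_mult'; [apply is_lim_seq_const|].
    apply is_lim_seq_geom. rewrite Rabs_pos_eq; lra.
  - destruct (ex_series_nonneg_bounded (fun n => kth_head n (S k)) 1) as [l Hl].
    { intros n. apply kth_head_nonneg. }
    { apply sum_kth_head_le_1. }
    assert (H1 : is_lim_seq (fun N => sum_n (fun n => kth_head n (S k)) (S N)) l)
      by (apply (is_lim_seq_incr_1 (sum_n (fun n => kth_head n (S k))) l); exact Hl).
    assert (H2 : is_lim_seq (fun N => sum_n (fun n => kth_head n (S k)) (S N))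
                   ((1 + l) / 2)).
    { eapply is_lim_seq_ext; [intros N; symmetry; apply sum_kth_head_S|].
      apply is_lim_seq_div';
        [apply is_lim_seq_plus'; [exact IH | exact Hl]
        | apply is_lim_seq_const | lra]. }
    apply is_lim_seq_unique in H1. apply is_lim_seq_unique in H2.
    rewrite H1 in H2. injection H2 as H2.
    replace 1 with l by lra. exact Hl.
Qed.

(** * Convergence of the p-series *)

(** This makes [1 / y^(s+1)] at [y = x + 1] the telescoping difference
    [(1 / x^s - 1 / y^s) / s], up to an inequality. It comes from
    [(y / x)^s >= 1 + s * ln (y / x)] and [ln (y / x) >= 1 / y]. *)
Lemma inv_Rpower_telescope (s x : R) : 0 < s -> 0 < x ->
  s * / Rpower (x + 1) (s + 1) <= / Rpower x s - / Rpower (x + 1) s.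
Proof.
  intros Hs Hx.
  assert (Hln : / (x + 1) <= ln (x + 1) - ln x).
  { assert (H : 1 + (ln x - ln (x + 1)) <= x / (x + 1)).
    { eapply Rle_trans; [apply exp_ineq1_le|].
      unfold Rminus. rewrite exp_plus, exp_Ropp, !exp_ln by lra.
      apply Rle_refl. }
    replace (x / (x + 1)) with (1 - / (x + 1)) in H by (field; lra). lra. }
  assert (Hinv : / Rpower x s
    = / Rpower (x + 1) s * exp (s * (ln (x + 1) - ln x))).
  { rewrite <- !Rpower_Ropp. unfold Rpower. rewrite <- exp_plus.
    f_equal. ring. }
  rewrite Hinv, Rpower_plus, Rpower_1, Rinv_mult by lra.
  assert (Hp : 0 < / Rpower (x + 1) s) by apply Rinv_0_lt_compat, exp_pos.
  assert (He := exp_ineq1_le (s * (ln (x + 1) - ln x))).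
  assert (s * / (x + 1) <= s * (ln (x + 1) - ln x))
    by (apply Rmult_le_compat_l; lra).
  assert (Hm : / Rpower (x + 1) s * (1 + s * / (x + 1))
    <= / Rpower (x + 1) s * exp (s * (ln (x + 1) - ln x)))
    by (apply Rmult_le_compat_l; lra).
  lra.
Qed.

Lemma ex_series_inv_Rpower (s : R) : 0 < s ->
  ex_series (fun n => / Rpower (INR (S n)) (s + 1)).
Proof.
  intros Hs.
  assert (Hpos : forall x t, 0 < / Rpower x t)
    by (intros; apply Rinv_0_lt_compat, exp_pos).
  assert (H1 : forall t, / Rpower (INR 1) t = 1).
  { intros t. rewrite INR_1. unfold Rpower. rewrite ln_1, Rmult_0_r, exp_0. field. }
  assert (Hsum : forall N,
    s * sum_n (fun n => / Rpower (INR (S n)) (s + 1)) N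
      <= s + 1 - / Rpower (INR (S N)) s).
  { induction N as [|N IH].
    - rewrite sum_O, !H1. lra.
    - rewrite sum_Sn. change plus with Rplus. rewrite Rmult_plus_distr_l.
      assert (HN : 0 < INR (S N)) by (apply lt_0_INR; lia).
      generalize (inv_Rpower_telescope s (INR (S N)) Hs HN).
      rewrite <- S_INR. simpl in IH |- *. lra. }
  apply ex_series_nonneg_bounded with ((s + 1) / s).
  - intros n. left. apply Hpos.
  - intros N. apply Rmult_le_reg_l with s; [lra|].
    replace (s * ((s + 1) / s)) with (s + 1) by (field; lra).
    generalize (Hsum N) (Hpos (INR (S N)) s). lra.
Qed.

(** * The accelerated Dirichlet series *)

(** [C (n+1) (k+1) / (n+1) = C n k / (k+1)]: this is what raises the exponent
    from [s] to [s + 1]. *)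
Lemma binomial_term (s c : R) (n k : nat) : (k <= n)%nat ->
  1 / (INR (S n) * 2 ^ S n) *
    (Binomial.C (S n) (S k) * (c / Rpower (INR (S k)) s)) =
  kth_head n k * (c / Rpower (INR (S k)) (s + 1)).
Proof.
  intros Hk. rewrite kth_head_binomial by assumption.
  assert (HSk : 0 < INR (S k)) by (apply lt_0_INR; lia).
  assert (HSn : 0 < INR (S n)) by (apply lt_0_INR; lia).
  rewrite Rpower_plus, Rpower_1 by assumption.
  unfold Binomial.C. simpl (S n - S k)%nat.
  rewrite !fact_simpl, !mult_INR.
  assert (Hp : Rpower (INR (S k)) s <> 0) by (apply Rgt_not_eq, exp_pos).
  field. repeat split;
    try apply INR_fact_neq_0; try apply pow_nonzero; try assumption; lra.
Qed.

Lemma dirichlet_acceleration (s : R) (a : nat -> R) : 0 < s ->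
  (forall k, Rabs (a k) <= 1) ->
  ex_series (from1 (fun n => a n / Rpower (INR n) (s + 1))) /\
  is_series
    (from1 (fun n => 1 / (INR n * 2 ^ n) *
       sum_n_m (fun k => Binomial.C n k * (a k / Rpower (INR k) s)) 1 n))
    (Series (from1 (fun n => a n / Rpower (INR n) (s + 1)))).
Proof.
  intros Hs Ha.
  set (b := from1 (fun n => a n / Rpower (INR n) (s + 1))).
  assert (Hb : ex_series (fun k => Rabs (b k))).
  { apply (ex_series_le (V := R_CompleteNormedModule))
      with (2 := ex_series_inv_Rpower s Hs).
    intros n. change norm with Rabs. rewrite Rabs_Rabsolu. unfold b, from1, Rdiv.
    assert (Hp : 0 < / Rpower (INR (S n)) (s + 1))
      by apply Rinv_0_lt_compat, exp_pos.
    rewrite Rabs_mult, (Rabs_pos_eq (/ _)) by lra.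
    specialize (Ha (S n)). nra. }
  split; [now apply ex_series_Rabs|].
  eapply is_series_ext; [|exact (is_series_triangular kth_head b
    kth_head_nonneg kth_head_early is_series_kth_head Hb)].
  intros n. unfold from1. rewrite <- sum_n_m_S.
  etransitivity; [|exact (sum_n_m_mult_l (K := R_Ring) _ _ _ _)].
  apply sum_n_m_ext_loc. intros k Hk. symmetry. apply binomial_term. lia.
Qed.

Theorem theorem4p3 (s : R) (hs : 0 < s) :
  (forall x : R, -1 <= x <= 1 ->
     ex_series (from1 (polylog_term (s + 1) x)) /\
     is_series
       (from1 (fun n => 1 / (INR n * 2 ^ n) *
          sum_n_m (fun k => Binomial.C n k * (x ^ k / Rpower (INR k) s)) 1 n))
       (polylog (s + 1) x)) /\
  (ex_series (from1 (zeta_term (s + 1))) /\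
   is_series
     (from1 (fun n => 1 / (INR n * 2 ^ n) *
        sum_n_m (fun k => Binomial.C n k * (1 / Rpower (INR k) s)) 1 n))
     (zeta (s + 1))) /\
  (ex_series (from1 (alt_zeta_term (s + 1))) /\
   is_series
     (from1 (fun n => 1 / (INR n * 2 ^ n) *
        sum_n_m (fun k => Binomial.C n k * ((-1) ^ (k + 1) / Rpower (INR k) s)) 1 n))
     (alt_zeta (s + 1))).
Proof.
  split; [|split].
  - intros x Hx. apply dirichlet_acceleration; [exact hs|].
    intros k. rewrite <- RPow_abs, <- (pow1 k).
    apply pow_incr. split; [apply Rabs_pos | now apply Rabs_le].
  - apply (dirichlet_acceleration s (fun _ => 1)); [exact hs|].
    intros _. rewrite Rabs_R1. lra.
  - apply (dirichlet_acceleration s (fun k => (-1) ^ (k + 1))); [exact hs|].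
    intros k. rewrite pow_1_abs. lra.
Qed.
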